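(* Let $M$ be a monoid. Then the following are equivalent. (1) $M$ has a right zero element. (2) $M$ has left cohomological dimension $0$. (3) $M$ has left geometric dimension $0$.
   Context: An element $z\in M$ is a right zero if $mz=z$ for all $m\in M$. The left cohomological dimension of $M$ is the shortest length of a projective resolution of the trivial left $\mathbb ZM$-module $\mathbb Z$ (on which all elements of $M$ act as the identity). Give $M$ the discrete topology. An $M$-set $P$ (set with left $M$-action) is projective if every surjective $M$-equivariant map onto $P$ has an $M$-equivariant section; equivalently $P\cong\coprod_{a\in A}Me_a$ with each $e_a\in M$ idempotent. $M$-sets are regarded as discrete $M$-spaces (an $M$-space being a space with continuous left $M$-action); $B^n$ and $S^{n-1}=\partial B^n$ carry trivial $M$-actions. A projective $M$-CW complex is an $M$-space $X=\varinjlim X_n$ (along inclusions) where $X_0=P_0$ is a projective $M$-set and, for $n\ge1$, $X_n$ is a pushout of $M$-spaces $X_n=X_{n-1}\cup_{P_n\times S^{n-1}}(P_n\times B^n)$ along an $M$-equivariant continuous map $P_n\times S^{n-1}\to X_{n-1}$, with $P_n$ a projective $M$-set. Its dimension is $n$ if $X=X_n$ and $P_n\ne\emptyset$. A (left) equivariant classifying space for $M$ is a contractible projective $M$-CW complex. The left geometric dimension of $M$ is the minimum dimension of a left equivariant classifying space for $M$. *)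

(* Defs.v *)
From HB Require Import structures.
From mathcomp Require Import all_boot all_order all_algebra finmap.
(* monalg must be imported before all_analysis: in the other order the parsing
   levels of the two libraries clash. *)
From mathcomp.multinomials Require Import monalg.
From mathcomp Require Import all_classical all_reals all_analysis.
Import Order.TTheory GRing.Theory Num.Theory.
Import numFieldNormedType.Exports.

Set Implicit Arguments.
Unset Strict Implicit.
Unset Printing Implicit Defensive.

Local Open Scope classical_set_scope.
Local Open Scope ring_scope.

Definition right_zero_elt (M : monoidType) (z : M) : Prop :=
  forall m : M, (m * z)%g = z.

(* The ring structure that monalg puts on {malg int[K]} is only available for
   monoids K in which x * y = 1 forces x = y = 1; we reuse the underlying
   Z-module of finitely supported functions M -> int, and put the convolution
   product on it for an arbitrary monoid. *)
Definition monoid_ring (M : monoidType) : Type := {malg int[M]}.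
Bind Scope ring_scope with monoid_ring.

HB.instance Definition _ (M : monoidType) :=
  GRing.Zmodule.copy (monoid_ring M) {malg int[M]}.

Section MonoidRing.
Variable M : monoidType.
Local Notation ZM := (monoid_ring M).
Implicit Types (a b c : ZM) (d : {fset M}).

Definition mring_one : ZM := << 1%g >>.

Definition mring_mul a b : ZM :=
  \sum_(k <- msupp a) \sum_(l <- msupp b) << a@_k * b@_l *g (k * l)%g >>.

Lemma mring_mulw d1 d2 a b :
  (msupp a `<=` d1)%fset -> (msupp b `<=` d2)%fset ->
  mring_mul a b =
  \sum_(k <- d1) \sum_(l <- d2) << a@_k * b@_l *g (k * l)%g >>.
Proof.
move=> le1 le2; rewrite /mring_mul (big_fset_incl _ le1) /=.
  apply/eq_bigr => k _; apply/big_fset_incl => // l _ /mcoeff_outdom ->.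
  by rewrite mulr0 monalgU0.
move=> k _ /mcoeff_outdom ak0; rewrite big1 // => l _.
by rewrite ak0 mul0r monalgU0.
Qed.

Lemma mring_mul0l : left_zero 0 mring_mul.
Proof. by move=> a; rewrite /mring_mul msupp0 big_seq_fset0. Qed.

Lemma mring_mul0r : right_zero 0 mring_mul.
Proof.
move=> a; rewrite /mring_mul big1 // => k _.
by rewrite msupp0 big_seq_fset0.
Qed.

Lemma mring_mulDl : left_distributive mring_mul +%R.
Proof.
move=> a b c; pose d := (msupp a `|` msupp b)%fset.
rewrite (mring_mulw (msuppD_le a b) (fsubset_refl (msupp c))).
rewrite (mring_mulw (fsubsetUl _ _ : (msupp a `<=` d)%fset)
                    (fsubset_refl (msupp c))).
rewrite (mring_mulw (fsubsetUr _ _ : (msupp b `<=` d)%fset)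
                    (fsubset_refl (msupp c))).
rewrite -big_split /=; apply/eq_bigr => k _.
rewrite -big_split /=; apply/eq_bigr => l _.
by rewrite mcoeffD mulrDl monalgUD.
Qed.

Lemma mring_mulDr : right_distributive mring_mul +%R.
Proof.
move=> a b c; pose d := (msupp b `|` msupp c)%fset.
rewrite (mring_mulw (fsubset_refl (msupp a)) (msuppD_le b c)).
rewrite (mring_mulw (fsubset_refl (msupp a))
                    (fsubsetUl _ _ : (msupp b `<=` d)%fset)).
rewrite (mring_mulw (fsubset_refl (msupp a))
                    (fsubsetUr _ _ : (msupp c `<=` d)%fset)).
rewrite -big_split /=; apply/eq_bigr => k _.
rewrite -big_split /=; apply/eq_bigr => l _.
by rewrite mcoeffD mulrDr monalgUD.
Qed.

Lemma mring_mulUU (x y : int) (k l : M) :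
  mring_mul << x *g k >> << y *g l >> = << x * y *g (k * l)%g >>.
Proof.
by rewrite (mring_mulw msuppU_le msuppU_le) !big_seq_fset1 !mcoeffUU.
Qed.

Lemma mring_mul_suml (I : Type) (r : seq I) (F : I -> ZM) a :
  mring_mul (\sum_(i <- r) F i) a = \sum_(i <- r) mring_mul (F i) a.
Proof.
by rewrite (big_morph (mring_mul^~ a)
              (fun x y => mring_mulDl x y a) (mring_mul0l a)).
Qed.

Lemma mring_mul_sumr (I : Type) (r : seq I) (F : I -> ZM) a :
  mring_mul a (\sum_(i <- r) F i) = \sum_(i <- r) mring_mul a (F i).
Proof. by rewrite (big_morph (mring_mul a) (mring_mulDr a) (mring_mul0r a)). Qed.

Lemma mring_mul1l : left_id mring_one mring_mul.
Proof.
move=> a; rewrite [in LHS](monalgE a) mring_mul_sumr [RHS]monalgE.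
by apply/eq_bigr => k _; rewrite mring_mulUU mul1r mul1g.
Qed.

Lemma mring_mul1r : right_id mring_one mring_mul.
Proof.
move=> a; rewrite [in LHS](monalgE a) mring_mul_suml [RHS]monalgE.
by apply/eq_bigr => k _; rewrite mring_mulUU mulr1 mulg1.
Qed.

Lemma mring_mulA : associative mring_mul.
Proof.
have mulE (x y : ZM) : mring_mul x y =
    \sum_(k <- msupp x) mring_mul << x@_k *g k >> y.
  by rewrite -mring_mul_suml -monalgE.
have mulE' (x y : ZM) : mring_mul x y =
    \sum_(k <- msupp y) mring_mul x << y@_k *g k >>.
  by rewrite -mring_mul_sumr -monalgE.
move=> a b c; rewrite [LHS]mulE (mulE a b) mring_mul_suml.
apply/eq_bigr => k _; rewrite (mulE b c) (mulE' _ b).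
rewrite mring_mul_suml mring_mul_sumr; apply/eq_bigr => l _.
rewrite (mulE' _ c) mring_mul_sumr [RHS]mulE'; apply/eq_bigr => m _.
by rewrite !mring_mulUU mulrA mulgA.
Qed.

Lemma mring_one_neq0 : mring_one != 0.
Proof. by rewrite monalgU_eq0 oner_eq0. Qed.

HB.instance Definition _ := GRing.Zmodule_isNzRing.Build ZM
  mring_mulA mring_mul1l mring_mul1r mring_mulDl mring_mulDr mring_one_neq0.

Definition augmentation a : int := \sum_(k <- msupp a) a@_k.

Lemma augmentationw d a :
  (msupp a `<=` d)%fset -> augmentation a = \sum_(k <- d) a@_k.
Proof.
by move=> le; apply/big_fset_incl => // k _ /mcoeff_outdom.
Qed.

Lemma augmentationD : {morph augmentation : a b / a + b}.
Proof.
move=> a b; pose d := (msupp a `|` msupp b)%fset.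
rewrite (augmentationw (msuppD_le a b)).
rewrite (augmentationw (fsubsetUl _ _ : (msupp a `<=` d)%fset)).
rewrite (augmentationw (fsubsetUr _ _ : (msupp b `<=` d)%fset)).
by rewrite -big_split /=; apply/eq_bigr => k _; rewrite mcoeffD.
Qed.

Lemma augmentationU (x : int) (k : M) : augmentation << x *g k >> = x.
Proof. by rewrite (augmentationw msuppU_le) big_seq_fset1 mcoeffUU. Qed.

Lemma augmentation_sum (I : Type) (r : seq I) (F : I -> ZM) :
  augmentation (\sum_(i <- r) F i) = \sum_(i <- r) augmentation (F i).
Proof.
apply: (big_morph augmentation augmentationD).
by rewrite /augmentation msupp0 big_seq_fset0.
Qed.

Lemma augmentation1 : augmentation 1 = 1.
Proof. exact: augmentationU. Qed.

Lemma augmentationM : {morph augmentation : a b / a * b}.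
Proof.
move=> a b; rewrite augmentation_sum mulr_suml; apply/eq_bigr => k _.
rewrite augmentation_sum mulr_sumr; apply/eq_bigr => l _.
by rewrite augmentationU.
Qed.

End MonoidRing.

(* The left ZM-module Z on which every m : M acts as the identity, cf
   trivial_modE; an arbitrary a : ZM then acts through its augmentation. *)
Definition trivial_mod (M : monoidType) : Type := int.

Section TrivialModule.
Variable M : monoidType.

HB.instance Definition _ := GRing.Zmodule.copy (trivial_mod M) int.

Definition trivial_scale (a : monoid_ring M) (x : trivial_mod M) :
  trivial_mod M := augmentation a * (x : int).

Lemma trivial_scaleA a b x :
  trivial_scale a (trivial_scale b x) = trivial_scale (a * b) x.
Proof. by rewrite /trivial_scale augmentationM mulrA. Qed.

Lemma trivial_scale1 : left_id 1 trivial_scale.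
Proof. by move=> x; rewrite /trivial_scale augmentation1 mul1r. Qed.

Lemma trivial_scaleDr : right_distributive trivial_scale +%R.
Proof. by move=> a x y; exact: mulrDr. Qed.

Lemma trivial_scaleDl x : {morph trivial_scale^~ x : a b / a + b}.
Proof. by move=> a b; rewrite /trivial_scale augmentationD; exact: mulrDl. Qed.

HB.instance Definition _ := GRing.Zmodule_isLmodule.Build (monoid_ring M)
  (trivial_mod M) trivial_scaleA trivial_scale1 trivial_scaleDr trivial_scaleDl.

Lemma trivial_modE (m : M) (x : trivial_mod M) :
  (<< m >> : monoid_ring M) *: x = x.
Proof.
transitivity (augmentation (<< m >> : monoid_ring M) * (x : int)) => //.
by rewrite augmentationU mul1r.
Qed.

End TrivialModule.

Definition projective_mod (A : nzRingType) (P : lmodType A) : Prop :=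
  forall (U V : lmodType A) (g : {linear U -> V}) (f : {linear P -> V}),
    (forall v, exists u, g u = v) ->
    exists h : {linear P -> U}, forall p, g (h p) = f p.

Record proj_resolution (A : nzRingType) (N : lmodType A) := ProjResolution {
  res_mod : nat -> lmodType A;
  res_diff : forall n, {linear res_mod n.+1 -> res_mod n};
  res_aug : {linear res_mod 0%N -> N};
  res_projective : forall n, projective_mod (res_mod n);
  res_aug_surj : forall y, exists x, res_aug x = y;
  res_exact0 : forall x, res_aug x = 0 <-> exists y, res_diff 0%N y = x;
  res_exact : forall n x, res_diff n x = 0 <-> exists y, res_diff n.+1 y = x
}.

Definition has_proj_resolution_of_length (A : nzRingType) (N : lmodType A)
    (n : nat) : Prop :=
  exists P : proj_resolution N,
    forall k, (n < k)%N -> forall x : res_mod P k, x = 0.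

(* "The left cohomological dimension of M is (defined, finite and equal to)
   n"; no n qualifies when it is infinite. *)
Definition left_cohomological_dim (M : monoidType) (n : nat) : Prop :=
  has_proj_resolution_of_length (trivial_mod M) n /\
  forall k, has_proj_resolution_of_length (trivial_mod M) k -> (n <= k)%N.

HB.mixin Record hasMAction (M : monoidType) X := {
  mact : M -> X -> X;
  mact1 : forall x, mact 1%g x = x;
  mactM : forall (m n : M) x, mact (m * n)%g x = mact m (mact n x)
}.

#[short(type="msetType")]
HB.structure Definition MSet (M : monoidType) :=
  { X of hasMAction M X & Choice X }.

HB.mixin Record MSet_isMSpace (M : monoidType) X & MSet M X & Topological X := {
  mact_continuous :
    continuous (fun p : discrete_topology M * X => mact (p.1 : M) p.2)
}.

#[short(type="mspaceType")]
HB.structure Definition MSpace (M : monoidType) :=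
  { X of MSet M X & Topological X & MSet_isMSpace M X }.

Definition equivariant (M : monoidType) (X Y : msetType M) (f : X -> Y) : Prop :=
  forall (m : M) x, f (mact m x) = mact m (f x).

Definition projective_mset (M : monoidType) (P : msetType M) : Prop :=
  forall (Q : msetType M) (f : Q -> P), equivariant f ->
    (forall p, exists q, f q = p) ->
    exists2 s : P -> Q, equivariant s & cancel s f.

Definition mspace_hom (M : monoidType) (X Y : mspaceType M) (f : X -> Y) : Prop :=
  continuous f /\ equivariant f.

Definition mspace_iso (M : monoidType) (X Y : mspaceType M) (f : X -> Y) : Prop :=
  mspace_hom f /\
  exists g : Y -> X, [/\ mspace_hom g, cancel f g & cancel g f].

Section DiscreteMSpace.
Variables (M : monoidType) (P : msetType M).
Local Notation T := (discrete_topology P).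

HB.instance Definition _ := hasMAction.Build M T
  (@mact1 M P) (@mactM M P).

Lemma discrete_mact_continuous :
  continuous (fun p : discrete_topology M * T => mact (p.1 : M) p.2 : T).
Proof.
move=> [m x] A /nbhs_singleton/= Amx; exists ([set m], [set x]) => /=.
  by split; exact: discrete_set1.
by move=> [n y] [/= -> ->].
Qed.

HB.instance Definition _ := MSet_isMSpace.Build M T discrete_mact_continuous.
End DiscreteMSpace.

Definition trivial_action (M : monoidType) (T : Type) : Type := T.

Section TrivialMSpace.
Variables (M : monoidType) (T : topologicalType).
Local Notation X := (trivial_action M T).

HB.instance Definition _ := Topological.copy X T.
HB.instance Definition _ := @hasMAction.Build M X (fun _ x => x)
  (fun _ => erefl) (fun _ _ _ => erefl).

Lemma trivial_mact_continuous :
  continuous (fun p : discrete_topology M * X => mact (p.1 : M) p.2 : X).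
Proof. by move=> [m x]; exact: cvg_snd. Qed.

HB.instance Definition _ := MSet_isMSpace.Build M X trivial_mact_continuous.
End TrivialMSpace.

Section ProductMSpace.
Variables (M : monoidType) (X Y : mspaceType M).

Definition prod_mact (m : M) (p : X * Y) : X * Y := (mact m p.1, mact m p.2).

Lemma prod_mact1 p : prod_mact 1%g p = p.
Proof. by case: p => x y; rewrite /prod_mact !mact1. Qed.

Lemma prod_mactM m n p : prod_mact (m * n)%g p = prod_mact m (prod_mact n p).
Proof. by rewrite /prod_mact !mactM. Qed.

HB.instance Definition _ := hasMAction.Build M (X * Y)%type
  prod_mact1 prod_mactM.

Lemma prod_mact_continuous :
  continuous (fun p : discrete_topology M * (X * Y) => mact (p.1 : M) p.2).
Proof.
pose T := (discrete_topology M * (X * Y))%type.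
have pairC (U V W : topologicalType) (f : U -> V) (g : U -> W) :
    continuous f -> continuous g -> continuous (fun u => (f u, g u)).
  move=> cf cg u A [[P Q] /= [fP gQ] sPQ].
  have fgPQ : nbhs u (f @^-1` P `&` g @^-1` Q).
    by apply: filterI; [exact: (cf u P fP)|exact: (cg u Q gQ)].
  by apply: filterS fgPQ => v [Pv Qv]; exact: sPQ.
have compC (U V W : topologicalType) (f : U -> V) (g : V -> W) :
    continuous f -> continuous g -> continuous (fun u => g (f u)).
  by move=> cf cg u; exact: (continuous_comp (cf u) (cg (f u))).
have c1 (U V : topologicalType) : continuous (fst : U * V -> U).
  by move=> u; exact: cvg_fst.
have c2 (U V : topologicalType) : continuous (snd : U * V -> V).
  by move=> u; exact: cvg_snd.
apply: (@pairC).
- apply: (compC T _ _ (fun p => (p.1, p.2.1)) _ _ (@mact_continuous M X)).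
  by apply: (@pairC); [exact: c1|apply: (@compC); [exact: c2|exact: c1]].
- apply: (compC T _ _ (fun p => (p.1, p.2.2)) _ _ (@mact_continuous M Y)).
  by apply: (@pairC); [exact: c1|apply: (@compC); exact: c2].
Qed.

HB.instance Definition _ := MSet_isMSpace.Build M (X * Y)%type
  prod_mact_continuous.
End ProductMSpace.

(* The square A -f-> B, A -g-> C, B -h-> D, C -k-> D. *)
Definition is_pushout (M : monoidType) (A B C D : mspaceType M)
    (f : A -> B) (g : A -> C) (h : B -> D) (k : C -> D) : Prop :=
  [/\ mspace_hom f /\ mspace_hom g, mspace_hom h /\ mspace_hom k,
      h \o f =1 k \o g &
      forall (Z : mspaceType M) (u : B -> Z) (v : C -> Z),
        mspace_hom u -> mspace_hom v -> u \o f =1 v \o g ->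
        exists! w : D -> Z, [/\ mspace_hom w, w \o h =1 u & w \o k =1 v]].

Definition is_seq_colimit (M : monoidType) (Xn : nat -> mspaceType M)
    (inc : forall n, Xn n -> Xn n.+1) (X : mspaceType M)
    (iota : forall n, Xn n -> X) : Prop :=
  [/\ forall n, mspace_hom (inc n), forall n, mspace_hom (iota n),
      forall n, iota n.+1 \o inc n =1 iota n &
      forall (Z : mspaceType M) (u : forall n, Xn n -> Z),
        (forall n, mspace_hom (u n)) -> (forall n, u n.+1 \o inc n =1 u n) ->
        exists! w : X -> Z, mspace_hom w /\ forall n, w \o iota n =1 u n].

Section BallSphere.
Variables (R : realType) (n : nat).

Definition ball_set : set 'rV[R]_n :=
  [set x | \sum_(i < n) x 0 i ^+ 2 <= 1].

Definition sphere_set : set 'rV[R]_n :=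
  [set x | \sum_(i < n) x 0 i ^+ 2 = 1].

Lemma sphere_sub_ball : sphere_set `<=` ball_set.
Proof. by move=> x; rewrite /sphere_set /ball_set /= => ->. Qed.

Definition unit_ball : topologicalType := set_type ball_set.
Definition unit_sphere : topologicalType := set_type sphere_set.

Definition sphere_to_ball (x : unit_sphere) : unit_ball :=
  exist _ (val x) (mem_set (sphere_sub_ball (set_mem (valP x)))).

End BallSphere.

Definition ball_cells (R : realType) (M : monoidType) (P : msetType M)
    (n : nat) : mspaceType M :=
  (discrete_topology P * trivial_action M (unit_ball R n))%type.

Definition sphere_cells (R : realType) (M : monoidType) (P : msetType M)
    (n : nat) : mspaceType M :=
  (discrete_topology P * trivial_action M (unit_sphere R n))%type.

Definition sphere_to_ball_cells (R : realType) (M : monoidType)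
    (P : msetType M) (n : nat) (p : sphere_cells R P n) : ball_cells R P n :=
  (p.1, sphere_to_ball p.2).

(* The equality X_0 = P_0 and the identification of X_n.+1 with the pushout are
   expressed up to isomorphism of M-spaces. The inclusions X_n -> X_n.+1 -> X
   are the maps cw_inc and cw_iota; they are injective since they come from
   pushouts along the injective maps sphere_to_ball_cells. *)
Record projective_MCW (R : realType) (M : monoidType) (X : mspaceType M) :=
  ProjectiveMCW {
    cw_skel : nat -> mspaceType M;
    cw_cells : nat -> msetType M;
    cw_inc : forall n, cw_skel n -> cw_skel n.+1;
    cw_iota : forall n, cw_skel n -> X;
    cw_base : discrete_topology (cw_cells 0%N) -> cw_skel 0%N;
    cw_attach : forall n, sphere_cells R (cw_cells n.+1) n.+1 -> cw_skel n;
    cw_char : forall n, ball_cells R (cw_cells n.+1) n.+1 -> cw_skel n.+1;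
    cw_projective : forall n, projective_mset (cw_cells n);
    cw_base_iso : mspace_iso cw_base;
    cw_pushout : forall n,
      is_pushout (@cw_attach n) (@sphere_to_ball_cells R M (cw_cells n.+1) n.+1)
                 (@cw_inc n) (@cw_char n);
    cw_colimit : is_seq_colimit cw_inc cw_iota
  }.

Arguments cw_inc {R M X} p n _.
Arguments cw_iota {R M X} p n _.
Arguments cw_attach {R M X} p n _.
Arguments cw_char {R M X} p n _.

Definition MCW_dim (R : realType) (M : monoidType) (X : mspaceType M)
    (C : projective_MCW R X) (n : nat) : Prop :=
  mspace_iso (cw_iota C n) /\ inhabited (cw_cells C n).

Definition contractible (R : realType) (X : topologicalType) : Prop :=
  exists (x0 : X) (H : X * R -> X),
    [/\ {within [set: X] `*` `[0, 1], continuous H},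
        forall x, H (x, 0) = x & forall x, H (x, 1) = x0].

Definition has_classifying_space_of_dim (R : realType) (M : monoidType)
    (n : nat) : Prop :=
  exists (X : mspaceType M) (C : projective_MCW R X),
    contractible R X /\ MCW_dim C n.

Definition left_geometric_dim (R : realType) (M : monoidType) (n : nat) : Prop :=
  has_classifying_space_of_dim R M n /\
  forall k, has_classifying_space_of_dim R M k -> (n <= k)%N.

(* Main.v *)
Require Import Defs.
From HB Require Import structures.
From mathcomp Require Import all_boot all_order all_algebra finmap.
From mathcomp.multinomials Require Import monalg.
From mathcomp Require Import all_classical all_reals all_analysis.

(** Both dimensions vanish exactly when a one-point object is projective, and
    that happens exactly when [M] has a right zero.

    Algebra.  A resolution of length [0] is an isomorphism onto the trivial
    module [Z], so cohomological dimension [0] says that [Z] is projective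
    ([left_cohomological_dim0P]).  If [z] is a right zero, then
    [Z] is the cyclic module [ZM z], and [k |-> (k z) u] lifts any map
    [Z -> V] once [u] lifts the image of [1]
    ([projective_trivial_mod_of_right_zero]).  Conversely a splitting of the
    augmentation [ZM -> Z] sends [1] to an element [a] of augmentation [1]
    with [m a = a] for every [m].  Then every [m] permutes the finite
    support [F] of [a] by left multiplication and preserves coefficients.  In
    particular [F] is a finite left ideal in which left multiplications are
    bijective.  Fix [x] in [F] and pass to [a x], which has the same two
    properties.  Its support lies in [F x], on which [M] acts transitively
    ([invariant_msupp_transitive]), so all its coefficients on the support are
    equal to one integer [c], and [c] times the size of the support is [1].
    Hence the support is a single element, fixed by all of [M]: a right zero
    ([right_zero_of_invariant]).

    Topology.  A classifying space of dimension [0] is a discrete projective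
    [M]-set; being contractible it has just one point, since a path in a
    discrete space is constant ([contractible_to_discrete_const]).  An
    equivariant section of the orbit map from [M] to that point is a right zero
    ([right_zero_of_projective_mset]).  Conversely a right zero makes the
    one-point [M]-set projective, and this point is a contractible complex
    without cells of positive dimension
    ([classifying_space_of_point]). *)

Set Implicit Arguments.
Unset Strict Implicit.
Unset Printing Implicit Defensive.

Import Order.TTheory GRing.Theory Num.Theory.

(** * Left invariant elements of the monoid ring *)

Section InvariantElements.
Local Open Scope ring_scope.

(** Pigeonhole, for an [f] that is not known beforehand to preserve [F]: the
    image of [F] contains [F] and has at most as many elements. *)
Lemma fset_surj_bij (T : choiceType) (F : {fset T}) (f : T -> T) :
  (forall k, k \in F -> exists2 l, l \in F & f l = k) ->
  {in F, forall l, f l \in F} /\ {in F &, injective f}.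
Proof.
move=> surj.
have sub : (F `<=` f @` F)%fset.
  by apply/fsubsetP => k /surj[l lF <-]; apply/imfsetP; exists l.
have imF : F = (f @` F)%fset.
  by apply/eqP; rewrite eqEfcard sub leq_imfset_card.
split=> [l lF|]; first by rewrite imF; apply/imfsetP; exists l.
by apply/card_in_imfsetP; rewrite -imF.
Qed.

Variable M : monoidType.
Implicit Types (a : monoid_ring M) (m : M).

Definition left_invariant a := forall m, (<< m >> : monoid_ring M) * a = a.

Lemma mcoeff_monomial_mul m a (k : M) :
  ((<< m >> : monoid_ring M) * a)@_k =
  \sum_(l <- msupp a) a@_l *+ ((m * l)%g == k).
Proof.
have -> : (<< m >> : monoid_ring M) * a =
    \sum_(l <- msupp a) << a@_l *g (m * l)%g >>.
  transitivity (mring_mul (<< m >> : monoid_ring M) a) => //.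
  rewrite (mring_mulw msuppU_le (fsubset_refl _)) big_seq_fset1.
  by apply: eq_bigr => l _; rewrite mcoeffUU mul1r.
by rewrite raddf_sum; apply: eq_bigr => l _; exact: mcoeffU.
Qed.

Section Support.
Variables (a : monoid_ring M) (a_inv : left_invariant a).

(** Otherwise [m a] would have coefficient [0] at [k]. *)
Lemma invariant_msupp_surj m k :
  k \in msupp a -> exists2 l, l \in msupp a & (m * l)%g = k.
Proof.
rewrite -mcoeff_neq0 -[a in a@_k](a_inv m) mcoeff_monomial_mul => sum_neq0.
have [//|noR] := pselect (exists2 l, l \in msupp a & (m * l)%g = k).
case/eqP: sum_neq0; rewrite big_seq big1 // => l la.
by case: eqP => // mlk; case: noR; exists l.
Qed.

Lemma invariant_msupp_closed m l : l \in msupp a -> (m * l)%g \in msupp a.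
Proof. by case: (fset_surj_bij (@invariant_msupp_surj m)) => + _; apply. Qed.

Lemma invariant_msupp_inj m : {in msupp a &, injective (fun l => (m * l)%g)}.
Proof. by case: (fset_surj_bij (@invariant_msupp_surj m)). Qed.

Lemma invariant_mcoeff m l : l \in msupp a -> a@_(m * l)%g = a@_l.
Proof.
move=> la; rewrite -[a in LHS](a_inv m) mcoeff_monomial_mul.
rewrite (bigD1_seq l) ?fset_uniq //= eqxx big_seq_cond big1 ?addr0 // => i.
case/andP=> ia i_neq_l; case: eqP => // mil; case/eqP: i_neq_l.
exact: (@invariant_msupp_inj m).
Qed.

(** The support is a finite left ideal in which all left multiplications are
    bijective.  Solving [f e = f] gives [e], a left identity because
    [f] can be cancelled.  For the same reason the solution [h] of [f h = e]
    also satisfies [h f = e], so [g h] sends [f x] to [g x]. *)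
Lemma invariant_msupp_transitive x f g :
  x \in msupp a -> f \in msupp a -> g \in msupp a ->
  exists m, (m * (f * x) = g * x)%g.
Proof.
move=> xa fa ga.
have [e ea fe] := invariant_msupp_surj f fa.
have ex : (e * x)%g = x.
  apply: (@invariant_msupp_inj f) => //; first exact: invariant_msupp_closed.
  by rewrite mulgA fe.
have [h ha fh] := invariant_msupp_surj f ea.
have hf : (h * f)%g = e.
  apply: (@invariant_msupp_inj f) => //; first exact: invariant_msupp_closed.
  rewrite mulgA fh fe.
  apply: (@invariant_msupp_inj f) => //; first exact: invariant_msupp_closed.
  by rewrite mulgA fe.
by exists (g * h)%g; rewrite -mulgA (mulgA h) hf ex.
Qed.

End Support.

Lemma msupp_mul_monomial a x (k : M) :
  k \in msupp (a * << x >>) -> exists2 f, f \in msupp a & k = (f * x)%g.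
Proof.
have -> : a * (<< x >> : monoid_ring M) =
    \sum_(l <- msupp a) << a@_l *g (l * x)%g >>.
  transitivity (mring_mul a (<< x >> : monoid_ring M)) => //.
  rewrite (mring_mulw (fsubset_refl _) msuppU_le); apply: eq_bigr => l _.
  by rewrite big_seq_fset1 mcoeffUU mulr1.
rewrite -mcoeff_neq0 raddf_sum /= => sum_neq0.
have [//|noR] := pselect (exists2 f, f \in msupp a & k = (f * x)%g).
case/eqP: sum_neq0; rewrite big_seq big1 // => l la.
transitivity (a@_l *+ ((l * x)%g == k)); first exact: mcoeffU.
by case: eqP => // lxk; case: noR; exists l.
Qed.

(** The support of [a] itself can have several [M]-orbits; right
    multiplication by some [x] in it collapses them to one. *)
Lemma right_zero_of_invariant a :
  left_invariant a -> augmentation a = 1 -> exists z : M, right_zero_elt z.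
Proof.
move=> a_inv aug_a.
have msupp_neq0 (b : monoid_ring M) : augmentation b = 1 -> exists x, x \in msupp b.
  move=> aug_b; apply/fset0Pn/eqP => b0; move: aug_b.
  by rewrite /augmentation b0 big_seq_fset0.
have [x xa] := msupp_neq0 _ aug_a.
pose b := a * (<< x >> : monoid_ring M).
have b_inv : left_invariant b by move=> m; rewrite /b mulrA a_inv.
have aug_b : augmentation b = 1.
  by rewrite /b augmentationM aug_a augmentationU.
have [z zb] := msupp_neq0 _ aug_b.
have b_const k : k \in msupp b -> b@_k = b@_z.
  move=> /msupp_mul_monomial[g ga ->].
  have [f fa zfx] := msupp_mul_monomial zb.
  have [m <-] := invariant_msupp_transitive a_inv xa fa ga.
  by rewrite -zfx invariant_mcoeff.
(* The common coefficient times the size of the support is [1] in [int]. *)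
have card1 : #|` msupp b|%fset = 1%N.
  move: aug_b; rewrite /augmentation big_seq (eq_bigr _ b_const) -big_seq.
  rewrite big_const_seq count_predT iter_addr_0 => aug_b.
  have := congr1 absz aug_b; rewrite -mulr_natr natz abszM /= => /eqP.
  by rewrite muln_eq1 => /andP[_ /eqP].
have supp_b : msupp b = [fset z]%fset.
  by apply/esym/eqP; rewrite eqEfcard fsub1set zb card1 cardfs1.
exists z => m; apply/fset1P; rewrite -supp_b; exact: invariant_msupp_closed.
Qed.
End InvariantElements.

(** * Projective resolutions of length zero *)

Section ProjectiveDimensionZero.
Local Open Scope ring_scope.
Variables (A : nzRingType) (N : lmodType A).

(** Exactness at degree [0] makes the augmentation of the resolution an
    isomorphism, along which projectivity is transported. *)
Lemma projective_mod_of_length0 :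
  has_proj_resolution_of_length N 0 -> projective_mod N.
Proof.
case=> P P_trivial U V g f g_surj.
have aug_inj : injective (res_aug P).
  move=> x y eq_xy; apply/eqP; rewrite -subr_eq0; apply/eqP.
  have /res_exact0[t <-] : res_aug P (x - y) = 0.
    by rewrite linearB eq_xy /= subrr.
  by rewrite (P_trivial 1%N isT t) linear0.
have [h hE] := @res_projective _ _ P 0%N _ _ g (f \o res_aug P) g_surj.
pose inv y := projT1 (cid (res_aug_surj P y)).
have invK y : res_aug P (inv y) = y by rewrite /inv; case: cid.
have inv_linear : linear inv.
  by move=> c x y; apply: aug_inj; rewrite linearP !invK.
pose invL : {linear N -> res_mod P 0%N} :=
  HB.pack inv (GRing.isLinear.Build _ _ _ _ inv inv_linear).
by exists (h \o invL) => y; rewrite /= hE /= invK.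
Qed.

Definition length0_mod (n : nat) : lmodType A :=
  if n is 0%N then N else 'rV[A]_0.

Lemma length0_mod_eq0 n (x : length0_mod n.+1) : x = 0.
Proof. exact: (thinmx0 (x : 'rV[A]_0)). Qed.

Definition length0_diff n : {linear length0_mod n.+1 -> length0_mod n} :=
  (\0 : {linear length0_mod n.+1 -> length0_mod n}).

Lemma projective_mod_zero : projective_mod ('rV[A]_0 : lmodType A).
Proof.
move=> U V g f _; exists (\0 : {linear 'rV[A]_0 -> U}) => p.
by rewrite (thinmx0 p) !linear0.
Qed.

Lemma length0_of_projective_mod :
  projective_mod N -> has_proj_resolution_of_length N 0.
Proof.
move=> N_proj.
have proj n : projective_mod (length0_mod n).
  by case: n => [//|n]; exact: projective_mod_zero.
unshelve eexists (@ProjResolution A N length0_mod length0_diff idfun proj _ _ _).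
- by move=> y; exists y.
- by move=> x; split=> [x0|[y <-] //]; exists 0; exact/esym.
- by move=> n x; split=> _; [exists 0; rewrite (length0_mod_eq0 x)|].
- by case=> // k _ x; exact: length0_mod_eq0.
Qed.

End ProjectiveDimensionZero.

(** * Projectivity of the trivial module *)

Section CohomologicalDimensionZero.
Local Open Scope ring_scope.
Variable M : monoidType.

Lemma left_cohomological_dim0P :
  left_cohomological_dim M 0 <-> projective_mod (trivial_mod M).
Proof.
split=> [[+ _]|/length0_of_projective_mod]; first exact: projective_mod_of_length0.
by move=> res; split.
Qed.

(** The augmentation as a map of left modules, from the regular module; its
    linearity is the multiplicativity of the augmentation. *)
Definition augmentation_mod (a : (monoid_ring M)^o) : trivial_mod M :=
  augmentation a.

Lemma augmentation_mod_linear : linear augmentation_mod.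
Proof.
move=> c a b; rewrite /augmentation_mod augmentationD.
by congr (_ + _); exact: augmentationM.
Qed.

HB.instance Definition _ := GRing.isLinear.Build (monoid_ring M)
  (monoid_ring M)^o (trivial_mod M) _ augmentation_mod augmentation_mod_linear.

(** A splitting of the augmentation sends [1], a fixed vector of the trivial
    module, to an invariant element of augmentation [1]. *)
Lemma right_zero_of_projective_trivial_mod :
  projective_mod (trivial_mod M) -> exists z : M, right_zero_elt z.
Proof.
move=> triv_proj.
have aug_surj y : exists a, augmentation_mod a = y.
  by exists (<< (y : int) *g 1%g >> : monoid_ring M); exact: augmentationU.
have [h hE] := triv_proj _ _ augmentation_mod (idfun : {linear _ -> _}) aug_surj.
apply: (@right_zero_of_invariant M (h (1 : int))); last exact: hE.
move=> m; transitivity (h ((<< m >> : monoid_ring M) *: ((1 : int) : trivial_mod M))).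
  by rewrite linearZ.
by rewrite trivial_modE.
Qed.

(** The left ideal generated by a right zero is a copy of the trivial module. *)
Lemma monoid_ring_mul_right_zero (z : M) (a : monoid_ring M) (c : int) :
  right_zero_elt z ->
  a * (<< c *g z >> : monoid_ring M) = << augmentation a * c *g z >>.
Proof.
move=> z_zero; transitivity (mring_mul a (<< c *g z >> : monoid_ring M)) => //.
rewrite (mring_mulw (fsubset_refl _) msuppU_le) /augmentation mulr_suml.
rewrite (big_morph _ (@monalgUD _ _ z) (@monalgU0 _ _ z)).
by apply: eq_bigr => k _; rewrite big_seq_fset1 mcoeffUU z_zero.
Qed.

Lemma projective_trivial_mod_of_right_zero (z : M) :
  right_zero_elt z -> projective_mod (trivial_mod M).
Proof.
move=> z_zero U V g f g_surj; have [u gu] := g_surj (f (1 : int)).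
pose h (k : trivial_mod M) : U := (<< (k : int) *g z >> : monoid_ring M) *: u.
have h_linear : linear h.
  move=> a x y; rewrite /h scalerA (monoid_ring_mul_right_zero _ _ z_zero).
  rewrite -scalerDl; congr (_ *: u); exact: monalgUD.
pose hL : {linear trivial_mod M -> U} :=
  HB.pack h (GRing.isLinear.Build _ _ _ _ h h_linear).
exists hL => k; rewrite [hL k]/(h k) /h linearZ /= gu -linearZ; congr (f _).
transitivity (augmentation (<< (k : int) *g z >> : monoid_ring M) * 1 : int) => //.
by rewrite augmentationU mulr1.
Qed.

End CohomologicalDimensionZero.

(** * Contractibility and discrete spaces *)

Section ContractibleDiscrete.
Local Open Scope classical_set_scope.
Local Open Scope ring_scope.

(** The contraction moves each point to the centre along a path, whose image in
    a discrete space is connected, hence a single point. *)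
Lemma contractible_to_discrete_const (R : realType) (X : topologicalType)
    (Y : discreteTopologicalType) (f : X -> Y) :
  contractible R X -> continuous f -> forall x y, f x = f y.
Proof.
move=> [x0 [H [H_cont H0 H1]]] f_cont.
suff f_x0 x : f x = f x0 by move=> x y; rewrite !f_x0.
pose path (t : R) := f (H (x, t)).
have path_cont : {within `[0, 1], continuous path}.
  apply/subspace_continuousP => t t01 U /f_cont HU.
  move/subspace_continuousP: H_cont => /(_ (x, t) (conj I t01) _ HU).
  case=> -[P Q] [/= /nbhs_singleton Px Qt] PQ.
  by apply: filterS Qt => s Qs s01; exact: (PQ (x, s) (conj Px Qs) (conj I s01)).
have path_conn := connected_continuous_connected (@segment_connected R 0 1) path_cont.
have p0 : (path @` `[0, 1]) (f x).
  by exists 0; [rewrite /= in_itv /= lexx ler01|rewrite /path H0].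
have : (path @` `[0, 1]) (f x0).
  by exists 1; [rewrite /= in_itv /= lexx ler01|rewrite /path H1].
rewrite -(path_conn ((path @` `[0, 1]) `&` [set f x])); first by case.
- by exists (f x).
- by exists [set f x] => //; exact: discrete_open.
- by exists [set f x] => //; exact: discrete_closed.
Qed.

End ContractibleDiscrete.

(** * Projectivity of the one-point set with action *)

Section RegularMSet.
Variable M : monoidType.

Definition regular_mset : Type := M.

HB.instance Definition _ := Choice.copy regular_mset M.
HB.instance Definition _ := hasMAction.Build M regular_mset
  (@mul1g M) (fun m n x => esym (mulgA m n x)).

End RegularMSet.

Section PointMSet.
Variable M : monoidType.

Definition point_mset (M : monoidType) : Type := unit.

HB.instance Definition _ := Choice.copy (point_mset M) unit.
HB.instance Definition _ := @hasMAction.Build M (point_mset M)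
  (fun _ x => x) (fun=> erefl) (fun _ _ => fun=> erefl).

Definition empty_mset (M : monoidType) : Type := void.

HB.instance Definition _ := Choice.copy (empty_mset M) void.
HB.instance Definition _ := @hasMAction.Build M (empty_mset M)
  (fun _ x => x) (fun=> erefl) (fun _ _ => fun=> erefl).

(** The point [z q] of [Q] is fixed by [M], whatever [q] is. *)
Lemma projective_point_mset (z : M) :
  right_zero_elt z -> projective_mset (point_mset M : msetType M).
Proof.
move=> z_zero Q f _ f_surj; have [q _] := f_surj tt.
exists (fun=> mact z q) => [m _|[]]; last by case: (f _).
by rewrite -mactM z_zero.
Qed.

Lemma projective_empty_mset : projective_mset (empty_mset M : msetType M).
Proof. by move=> Q f _ _; exists (of_void Q) => [m []|[]]. Qed.

(** A section of the orbit map [M -> P] picks an element of [M] fixed by left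
    multiplication. *)
Lemma right_zero_of_projective_mset (P : msetType M) :
  projective_mset P -> inhabited P -> (forall x y : P, x = y) ->
  exists z : M, right_zero_elt z.
Proof.
move=> P_proj [p] P_point.
pose f (m : regular_mset M) : P := mact m p.
have f_equiv : equivariant f by move=> m n; exact: mactM.
have [|s s_equiv _] := P_proj _ f f_equiv.
  by move=> q; exists 1%g; exact: P_point.
exists (s p) => m; rewrite [LHS](_ : _ = mact m (s p)) //.
by rewrite -s_equiv; congr s; exact: P_point.
Qed.

End PointMSet.

(** * Zero-dimensional complexes *)

Section DiscreteMCW.
Variables (R : realType) (M : monoidType).

Lemma mspace_hom_id (X : mspaceType M) : mspace_hom (@id X).
Proof. by split=> // x; exact: cvg_id. Qed.

Lemma mspace_iso_id (X : mspaceType M) : mspace_iso (@id X).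
Proof.
by split; [|exists id; split=> //]; exact: mspace_hom_id.
Qed.

Lemma mspace_hom_empty (A X : mspaceType M) (f : A -> X) :
  (A -> False) -> mspace_hom f.
Proof. by move=> A0; split=> [a|m a]; case: (A0 a). Qed.

(** Attaching no cells changes nothing. *)
Lemma pushout_empty (A B X : mspaceType M) (f : A -> X) (g : A -> B) (k : B -> X) :
  (B -> False) -> is_pushout f g id k.
Proof.
move=> B0; have A0 a : False := B0 (g a).
split; [by split; exact: mspace_hom_empty|split|by move=> a; case: (A0 a)|].
- exact: mspace_hom_id.
- exact: mspace_hom_empty.
move=> Z u v u_hom v_hom _; exists u; split.
  by split=> // b; case: (B0 b).
by move=> w [_ wu _]; apply/funext => x; rewrite -wu.
Qed.

Lemma seq_colimit_const (X : mspaceType M) :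
  is_seq_colimit (Xn := fun=> X) (fun=> id) (fun=> id : X -> X).
Proof.
split=> [n|n|//|Z u u_hom u_inc]; try exact: mspace_hom_id.
have u0 n : u n =1 u 0%N.
  by elim: n => // n IH x; rewrite -IH; exact: u_inc.
exists (u 0%N); split=> [|w [_ wu]]; last by apply/funext => x; rewrite -(wu 0%N).
by split=> // n x; rewrite u0.
Qed.

Variable P : msetType M.

Definition discrete_cells (n : nat) : msetType M :=
  if n is 0%N then P else empty_mset M.

(** A discrete projective [M]-set is a complex all of whose skeleta are itself;
    it ends with [Defined] because the dimension of the complex is read off
    from the skeleta and cells given here. *)
Definition discrete_MCW (P_proj : projective_mset P) :
  projective_MCW R (discrete_topology P : mspaceType M).
Proof.
unshelve eapply (@ProjectiveMCW R M (discrete_topology P)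
  (fun=> discrete_topology P) discrete_cells (fun=> id) (fun=> id) id
  (fun n p => of_void _ p.1) (fun n p => of_void _ p.1)).
- by case=> [//|n]; exact: projective_empty_mset.
- exact: mspace_iso_id.
- by move=> n; apply: pushout_empty; case=> -[].
- exact: seq_colimit_const.
Defined.

Lemma classifying_space_of_point :
  projective_mset P -> inhabited P -> (forall x y : P, x = y) ->
  has_classifying_space_of_dim R M 0.
Proof.
move=> P_proj [p] P_point; exists (discrete_topology P : mspaceType M).
exists (discrete_MCW P_proj); split; last by split; [exact: mspace_iso_id|].
exists p, fst; split=> [|//|x]; last exact: P_point.
by apply: continuous_subspaceT => y; exact: cvg_fst.
Qed.

End DiscreteMCW.

Section GeometricDimensionZero.
Variables (R : realType) (M : monoidType).

(** Dimension [0] makes the whole space homeomorphic to its discrete set of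
    vertices. *)
Lemma classifying_space_dim0_point :
  has_classifying_space_of_dim R M 0 ->
  exists P : msetType M,
    [/\ projective_mset P, inhabited P & forall x y : P, x = y].
Proof.
case=> X [C [X_contr [[[iota_cont _] [g [[g_cont _] iotaK gK]]] P_inh]]].
exists (cw_cells C 0%N); split=> //; first exact: cw_projective.
have [[base_cont _] [b [[b_cont _] baseK bK]]] := cw_base_iso C.
have const := @contractible_to_discrete_const R X
  (discrete_topology (cw_cells C 0%N)) (b \o g) X_contr.
move=> x y.
have bg_cont : continuous (b \o g).
  by move=> z; apply: continuous_comp; [exact: g_cont|exact: b_cont].
have := const bg_cont (cw_iota C 0%N (@cw_base _ _ _ C x)) (cw_iota C 0%N (@cw_base _ _ _ C y)).
by rewrite /= !iotaK !baseK.
Qed.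

Lemma left_geometric_dim0_right_zero :
  left_geometric_dim R M 0 <-> exists z : M, right_zero_elt z.
Proof.
split=> [[/classifying_space_dim0_point[P []] + + + _]|[z z_zero]].
  exact: right_zero_of_projective_mset.
split=> //; apply: (@classifying_space_of_point R M (point_mset M)).
- exact: projective_point_mset z_zero.
- by constructor; exact: tt.
- by case=> -[].
Qed.

End GeometricDimensionZero.

(** * The equivalence *)

(* R is any model of the real numbers; it is used for balls, spheres and
   homotopies only. *)
Theorem proposition6p28 (R : realType) (M : monoidType) :
  [<-> exists z : M, right_zero_elt z;
       left_cohomological_dim M 0;
       left_geometric_dim R M 0].
Proof.
tfae.
- case=> z z_zero; apply/left_cohomological_dim0P.
  exact: projective_trivial_mod_of_right_zero z_zero.
- move=> /left_cohomological_dim0P/right_zero_of_projective_trivial_mod.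
  by move/left_geometric_dim0_right_zero.
- by move/left_geometric_dim0_right_zero.
Qed.
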